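(* Let $k$ be an algebraically closed field of characteristic $p>0$, let $(\mathfrak{g},[p])$ be a finite-dimensional restricted Lie algebra over $k$, and let $M$ be a finite-dimensional $U_0(\mathfrak{g})$-module of constant rank $d$. Then: (1) If $V(\mathfrak{g})=\{x\in\mathfrak{g} : x^{[p]}=0\}$ is a subspace of $\mathfrak{g}$, then the morphism $\mathrm{im}_M:\mathbb{P}(V(\mathfrak{g}))\to\mathrm{Gr}_d(M)$, $[x]\mapsto\mathrm{im}\,x_M$, is injective or constant. (2) If $V(\mathfrak{g})\cap C(\mathfrak{g})\neq(0)$ and $\mathrm{im}_M$ is constant, then $M$ has the equal images property.
   Context: $U_0(\mathfrak{g})=U(\mathfrak{g})/(\{x^p-x^{[p]} : x\in\mathfrak{g}\})$ is the restricted enveloping algebra, $C(\mathfrak{g})=\{x\in\mathfrak{g} : [x,\mathfrak{g}]=(0)\}$ is the center. For $x\in\mathfrak{g}$, $x_M:M\to M$ is the operator $m\mapsto x.m$. In general $V(\mathfrak{g})$ is a conical closed subset of $\mathfrak{g}$, and $\mathbb{P}(V(\mathfrak{g}))\subseteq\mathbb{P}(\mathfrak{g})$ is the corresponding projective variety. $M$ has constant rank $d$ if $\mathrm{rk}(x_M)=d$ for all $x\in V(\mathfrak{g})\setminus\{0\}$. $\mathrm{Gr}_d(M)$ is the Grassmannian of $d$-dimensional subspaces of $M$. $M$ has the equal images property if $\mathrm{im}\,x_M^j=\mathrm{im}\,y_M^j$ for all $x,y\in V(\mathfrak{g})\setminus\{0\}$ and all $j\in\{1,\ldots,p-1\}$.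 *)

(* Defs.v *)
From HB Require Import structures.
From mathcomp Require Import all_boot all_order all_algebra.
From mathcomp Require Import boolp.
From mathcomp Require Import finmap.
From mathcomp Require Import monalg.

Set Implicit Arguments.
Unset Strict Implicit.
Unset Printing Implicit Defensive.

Import GRing.Theory.
Local Open Scope ring_scope.
Local Open Scope quotient_scope.

HB.mixin Record Vector_isLieAlgebra (k : fieldType) g of Vector k g := {
  lieb : g -> g -> g;
  lieb_linearl : forall y, linear (lieb^~ y);
  lieb_linearr : forall x, linear (lieb x);
  lieb_alt : forall x, lieb x x = 0;
  lieb_jacobi : forall x y z,
    lieb x (lieb y z) + lieb y (lieb z x) + lieb z (lieb x y) = 0
}.

#[short(type="lieAlgType")]
HB.structure Definition LieAlgebra (k : fieldType) :=
  {g of Vector k g & Vector_isLieAlgebra k g}.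

Section Jacobson.
Variables (k : fieldType) (g : lieAlgType k).

(* Coefficient of t^j in ad(t x + y)^n (x), computed in g (x) k[t]. *)
Fixpoint ad_coef (x y : g) (n j : nat) : g :=
  match n with
  | 0 => if j is 0 then x else 0
  | n'.+1 => (if j is j'.+1 then lieb x (ad_coef x y n' j') else 0)
             + lieb y (ad_coef x y n' j)
  end.

(* Jacobson's s_i, determined for 0 < i < p in characteristic p by
   ad(t x + y)^(p-1) (x) = \sum_(1 <= i < p) i s_i(x, y) t^(i-1). *)
Definition jacobson_s (p i : nat) (x y : g) : g :=
  (i%:R : k)^-1 *: ad_coef x y p.-1 i.-1.

End Jacobson.

HB.mixin Record LieAlgebra_isRestricted (p : nat) (k : fieldType) g
    of LieAlgebra k g := {
  restricted_pchar : p \in [pchar k];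
  ppow : g -> g;
  lieb_ppow : forall x y, lieb (ppow x) y = iter p (lieb x) y;
  ppowZ : forall (a : k) x, ppow (a *: x) = a ^+ p *: ppow x;
  ppowD : forall x y,
    ppow (x + y) = ppow x + ppow y + \sum_(1 <= i < p) jacobson_s p i x y
}.

#[short(type="restrictedLieAlgType")]
HB.structure Definition RestrictedLieAlgebra (p : nat) (k : fieldType) :=
  {g of LieAlgebra k g & LieAlgebra_isRestricted p k g}.

Section Ideal.
Variables (k : fieldType) (A : algType k) (S : A -> Prop).

Inductive ideal : A -> Prop :=
| ideal_gen a of S a : ideal a
| ideal0 : ideal 0
| idealD a b of ideal a & ideal b : ideal (a + b)
| idealMl a b of ideal b : ideal (a * b)
| idealMr a b of ideal a : ideal (a * b).

Lemma idealN a : ideal a -> ideal (- a).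
Proof. by rewrite -mulN1r; exact: idealMl. Qed.

Lemma idealZ (c : k) a : ideal a -> ideal (c *: a).
Proof. by rewrite -[a in c *: a]mul1r scalerAl; exact: idealMl. Qed.

Lemma ideal_ker (B : nzRingType) (f : {rmorphism A -> B}) :
  (forall a, S a -> f a = 0) -> forall a, ideal a -> f a = 0.
Proof.
move=> fS a; elim=> {a} [a /fS//||a b _ fa _ fb|a b _ fb|a b _ fa].
- exact: rmorph0.
- by rewrite rmorphD fa fb addr0.
- by rewrite rmorphM fb mulr0.
- by rewrite rmorphM fa mul0r.
Qed.

Definition ideal_rel : rel A := fun a b => `[< ideal (a - b) >].

Lemma ideal_rel_equiv : equiv_class_of ideal_rel.
Proof.
split=> [a|a b|b a c].
- by apply/asboolP; rewrite subrr; exact: ideal0.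
- by apply/asboolP/asboolP => /idealN; rewrite opprB.
- move=> /asboolP Iab /asboolP Ibc; apply/asboolP.
  by rewrite -(subrK b a) -addrA; exact: idealD.
Qed.

Canonical ideal_equiv := EquivRelPack ideal_rel_equiv.
Canonical ideal_encModRel := defaultEncModRel ideal_rel.

End Ideal.

(* Quotient of A by the two-sided ideal generated by S. As algebras of the
   library are nonzero, the ideal is required to be proper. *)
Definition alg_quot (k : fieldType) (A : algType k) (S : A -> Prop)
  (properS : ~ ideal S 1) := {eq_quot (ideal_rel S)}.

Fact quot_key : unit. Proof. by []. Qed.

Section Quotient.
Variables (k : fieldType) (A : algType k) (S : A -> Prop).
Hypothesis properS : ~ ideal S 1.
Local Notation Q := (alg_quot properS).

HB.instance Definition _ := Choice.on Q.
HB.instance Definition _ := EqQuotient.on Q.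

Local Notation piQ := (\pi_Q : A -> Q).

Lemma alg_quot_eqP (a b : A) : piQ a = piQ b <-> ideal S (a - b).
Proof. by split=> [/eqmodP/asboolP|Iab]; last exact/eqmodP/asboolP. Qed.

Definition quot_add := locked_with quot_key
  (fun u v : Q => piQ (repr u + repr v)).
Definition quot_opp := locked_with quot_key (fun u : Q => piQ (- repr u)).
Definition quot_mul := locked_with quot_key
  (fun u v : Q => piQ (repr u * repr v)).
Definition quot_scale := locked_with quot_key
  (fun (c : k) (u : Q) => piQ (c *: repr u)).
Local Notation add := quot_add.
Local Notation opp := quot_opp.
Local Notation mul := quot_mul.
Local Notation scale := quot_scale.

Let reprI (a : A) : ideal S (repr (piQ a) - a).
Proof. by apply/alg_quot_eqP; rewrite reprK. Qed.

Let addE a b : add (piQ a) (piQ b) = piQ (a + b).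
Proof.
rewrite /quot_add locked_withE; apply/alg_quot_eqP; rewrite opprD addrACA.
exact: idealD (reprI a) (reprI b).
Qed.

Let oppE a : opp (piQ a) = piQ (- a).
Proof.
rewrite /quot_opp locked_withE; apply/alg_quot_eqP.
by rewrite -opprD; apply/idealN/reprI.
Qed.

Let mulE a b : mul (piQ a) (piQ b) = piQ (a * b).
Proof.
rewrite /quot_mul locked_withE; apply/alg_quot_eqP.
rewrite -(subrK (a * repr (piQ b)) (_ * _)) -mulrBl -addrA -mulrBr.
apply: idealD; first exact/idealMr/reprI.
exact/idealMl/reprI.
Qed.

Let scaleE c a : scale c (piQ a) = piQ (c *: a).
Proof.
rewrite /quot_scale locked_withE; apply/alg_quot_eqP.
by rewrite -scalerBr; apply/idealZ/reprI.
Qed.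

Let qind (P : Q -> Prop) : (forall a, P (piQ a)) -> forall u, P u.
Proof. by move=> Ppi u; rewrite -[u]reprK; exact: Ppi. Qed.

Let addA : associative add.
Proof. by do 3!elim/qind=> ?; rewrite !addE addrA. Qed.
Let addC : commutative add.
Proof. by do 2!elim/qind=> ?; rewrite !addE addrC. Qed.
Let add0 : left_id (piQ 0) add.
Proof. by elim/qind=> ?; rewrite addE add0r. Qed.
Let addN : left_inverse (piQ 0) opp add.
Proof. by elim/qind=> ?; rewrite oppE addE addNr. Qed.
HB.instance Definition _ := GRing.isZmodule.Build Q addA addC add0 addN.

Let mulA : associative mul.
Proof. by do 3!elim/qind=> ?; rewrite !mulE mulrA. Qed.
Let mul1 : left_id (piQ 1) mul.
Proof. by elim/qind=> ?; rewrite mulE mul1r. Qed.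
Let mulr1' : right_id (piQ 1) mul.
Proof. by elim/qind=> ?; rewrite mulE mulr1. Qed.
Let mulDl : left_distributive mul +%R.
Proof. by do 3!elim/qind=> ?; rewrite /GRing.add/= !(addE, mulE) mulrDl. Qed.
Let mulDr : right_distributive mul +%R.
Proof. by do 3!elim/qind=> ?; rewrite /GRing.add/= !(addE, mulE) mulrDr. Qed.
Let one_neq0 : piQ 1 != 0.
Proof. by apply/eqP=> /alg_quot_eqP; rewrite subr0. Qed.
HB.instance Definition _ := GRing.Zmodule_isNzRing.Build Q
  mulA mul1 mulr1' mulDl mulDr one_neq0.

Let scaleA c d u : scale c (scale d u) = scale (c * d) u.
Proof. by elim/qind: u => a; rewrite !scaleE scalerA. Qed.
Let scale1 : left_id 1 scale.
Proof. by elim/qind=> a; rewrite scaleE scale1r. Qed.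
Let scaleDr : right_distributive scale +%R.
Proof.
by move=> c; do 2!elim/qind=> ?; rewrite /GRing.add/= !(addE, scaleE) scalerDr.
Qed.
Let scaleDl u : {morph scale^~ u : c d / c + d}.
Proof.
elim/qind: u => a c d.
by rewrite [RHS]/GRing.add/= !scaleE addE scalerDl.
Qed.
HB.instance Definition _ := GRing.Zmodule_isLmodule.Build k Q
  scaleA scale1 scaleDr scaleDl.

Let scaleAl (c : k) (u v : Q) : c *: (u * v) = (c *: u) * v.
Proof.
elim/qind: u => a; elim/qind: v => b.
by rewrite /GRing.mul/GRing.scale/= !(mulE, scaleE) scalerAl.
Qed.
HB.instance Definition _ := GRing.Lmodule_isLalgebra.Build k Q scaleAl.

Let scaleAr (c : k) (u v : Q) : c *: (u * v) = u * (c *: v).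
Proof.
elim/qind: u => a; elim/qind: v => b.
by rewrite /GRing.mul/GRing.scale/= !(mulE, scaleE) scalerAr.
Qed.
HB.instance Definition _ := GRing.Lalgebra_isAlgebra.Build k Q scaleAr.

Definition quot_pi (a : A) : Q := piQ a.

Let quot_piB : {morph quot_pi : a b / a - b}.
Proof.
by move=> a b; rewrite /GRing.add /GRing.opp/= /quot_pi oppE addE.
Qed.
HB.instance Definition _ := GRing.isZmodMorphism.Build A Q quot_pi quot_piB.

Let quot_pi_monoid : monoid_morphism quot_pi.
Proof. by split=> // a b; rewrite /GRing.mul/= /quot_pi mulE. Qed.
HB.instance Definition _ := GRing.isMonoidMorphism.Build A Q quot_pi
  quot_pi_monoid.

Lemma quot_piZ : scalable quot_pi.
Proof. by move=> c a; rewrite /GRing.scale/= /quot_pi scaleE. Qed.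
HB.instance Definition _ := GRing.isScalable.Build k A Q _ quot_pi quot_piZ.

Lemma quot_pi_eq0 a : quot_pi a = 0 <-> ideal S a.
Proof. by rewrite -[a in ideal S a]subr0 -alg_quot_eqP. Qed.

Section Lift.
Variables (B : nzRingType) (f : {rmorphism A -> B}).
Hypothesis fS : forall a, S a -> f a = 0.

Definition quot_lift of (forall a, S a -> f a = 0) :=
  fun u : Q => f (repr u).
Local Notation fQ := (quot_lift fS).

Lemma quot_lift_pi a : fQ (quot_pi a) = f a.
Proof.
by apply/subr0_eq; rewrite /quot_lift -rmorphB; apply: (ideal_ker fS); exact: reprI.
Qed.

Let quot_liftB : {morph fQ : u v / u - v}.
Proof.
elim/qind=> a; elim/qind=> b.
by rewrite -[piQ a]/(quot_pi a) -[piQ b]/(quot_pi b) -rmorphB !quot_lift_pi rmorphB.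
Qed.
HB.instance Definition _ := GRing.isZmodMorphism.Build Q B fQ quot_liftB.

Let quot_lift_monoid : monoid_morphism fQ.
Proof.
split; first by rewrite -[1]/(quot_pi 1) quot_lift_pi rmorph1.
elim/qind=> a; elim/qind=> b.
by rewrite -[piQ a]/(quot_pi a) -[piQ b]/(quot_pi b) -rmorphM !quot_lift_pi rmorphM.
Qed.
HB.instance Definition _ := GRing.isMonoidMorphism.Build Q B fQ
  quot_lift_monoid.

End Lift.

End Quotient.

Section FreeAlgebra.
Variables (k : fieldType) (I : choiceType).

Let malg_scaleAr (c : k) (a b : malg (fmonom I) k) :
  c *: (a * b) = a * (c *: b).
Proof.
apply/malgP=> m.
rewrite [LHS](mcoeffZ c (a * b) m).
rewrite [X in c * X](mcoeffMl a b m).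
rewrite (mcoeffMlw _ (fsubset_refl _) (msuppZ_le c b)).
rewrite mulr_sumr; apply: eq_bigr => m1 _; rewrite mulr_sumr.
by apply: eq_bigr => m2 _; rewrite (mcoeffZ c b) mulrCA mulrnAr.
Qed.

Definition free_alg := malg (fmonom I) k.
HB.instance Definition _ := GRing.Lalgebra.on free_alg.
HB.instance Definition _ := GRing.Lalgebra_isAlgebra.Build k free_alg
  malg_scaleAr.

Definition free_gen (i : I) : free_alg := mkmalgU (fmu i) 1.

Definition free_aug (a : free_alg) : k := mcoeff (fmone I) a.
HB.instance Definition _ := GRing.RMorphism.copy free_aug
  (mcoeff (fmone I) : malg (fmonom I) k -> k).

Lemma free_augZ (c : k) (a : free_alg) : free_aug (c *: a) = c * free_aug a.
Proof. exact: mcoeffZ. Qed.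

Lemma free_augD (a b : free_alg) : free_aug (a + b) = free_aug a + free_aug b.
Proof. exact: mcoeffD. Qed.

Lemma free_augB (a b : free_alg) : free_aug (a - b) = free_aug a - free_aug b.
Proof. exact: mcoeffB. Qed.

Lemma free_augM (a b : free_alg) : free_aug (a * b) = free_aug a * free_aug b.
Proof. exact: (rmorphM (@mcoeff (fmonom I) k (fmone I))). Qed.

Lemma free_aug_gen i : free_aug (free_gen i) = 0.
Proof.
by rewrite /free_aug /free_gen mcoeffU fmP fmuE fmoneE.
Qed.

End FreeAlgebra.

Section EnvelopingAlgebra.
Variables (k : fieldType) (g : lieAlgType k).

Definition env_gen (x : g) : free_alg k g := free_gen k x.

(* The first family of relations presents the tensor algebra of g as a
   quotient of the free algebra on the set g. *)
Variant env_rel : free_alg k g -> Prop :=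
| env_rel_linear (c : k) (x y : g) :
    env_rel (env_gen (c *: x + y) - (c *: env_gen x + env_gen y))
| env_rel_lieb (x y : g) :
    env_rel (env_gen x * env_gen y - env_gen y * env_gen x
             - env_gen (lieb x y)).

Lemma free_aug_env_gen x : free_aug (env_gen x) = 0.
Proof. exact: free_aug_gen. Qed.

Lemma free_aug_env_rel a : env_rel a -> free_aug a = 0.
Proof.
case=> [c x y|x y].
  by rewrite free_augB free_augD free_augZ !free_aug_env_gen mulr0 addr0 subrr.
rewrite (free_augB (_ - _)) (free_augB (_ * _)).
rewrite [X in X - _ - _]free_augM [X in _ - X - _]free_augM.
by rewrite !free_aug_env_gen mulr0 !subr0.
Qed.

Lemma env_rel_proper : ~ ideal env_rel 1.
Proof.
by move=> /(ideal_ker free_aug_env_rel)/eqP; rewrite rmorph1 oner_eq0.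
Qed.

Definition env_alg := alg_quot env_rel_proper.
HB.instance Definition _ := GRing.Algebra.on env_alg.

Definition env_inj (x : g) : env_alg := quot_pi env_rel_proper (env_gen x).

Lemma env_inj_is_linear : linear env_inj.
Proof.
move=> c x y.
have /(quot_pi_eq0 env_rel_proper) := ideal_gen (env_rel_linear c x y).
by rewrite rmorphB rmorphD /= quot_piZ => /subr0_eq.
Qed.
HB.instance Definition _ := GRing.isLinear.Build k g env_alg _ env_inj
  env_inj_is_linear.

Lemma env_inj_lieb x y :
  env_inj (lieb x y) = env_inj x * env_inj y - env_inj y * env_inj x.
Proof.
have /(quot_pi_eq0 env_rel_proper) := ideal_gen (env_rel_lieb x y).
rewrite (rmorphB _ (_ - _)) (rmorphB _ (_ * _)).
rewrite [X in X - _ - _]rmorphM [X in _ - X - _]rmorphM.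
by move=> /subr0_eq/esym.
Qed.

Definition env_aug : {rmorphism env_alg -> k} :=
  quot_lift (properS := env_rel_proper) free_aug_env_rel.

Lemma env_aug_inj x : env_aug (env_inj x) = 0.
Proof.
exact: etrans (quot_lift_pi env_rel_proper free_aug_env_rel _)
              (free_aug_env_gen x).
Qed.

End EnvelopingAlgebra.

Section RestrictedEnvelopingAlgebra.
Variables (p : nat) (k : fieldType) (g : restrictedLieAlgType p k).

Variant renv_rel : env_alg g -> Prop :=
  RenvRel x : renv_rel (env_inj x ^+ p - env_inj (ppow x)).

Lemma env_aug_renv_rel u : renv_rel u -> env_aug g u = 0.
Proof.
case=> x; rewrite rmorphB rmorphXn !env_aug_inj.
have /andP[/prime_gt0 p_gt0 _] : p \in [pchar k] := @restricted_pchar p k g.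
by rewrite expr0n eqn0Ngt p_gt0 subrr.
Qed.

Lemma renv_rel_proper : ~ ideal renv_rel 1.
Proof.
by move=> /(ideal_ker env_aug_renv_rel)/eqP; rewrite rmorph1 oner_eq0.
Qed.

Definition renv_alg := alg_quot renv_rel_proper.
HB.instance Definition _ := GRing.Algebra.on renv_alg.

Definition renv_inj (x : g) : renv_alg := quot_pi renv_rel_proper (env_inj x).

HB.instance Definition _ := GRing.Linear.copy renv_inj
  (quot_pi renv_rel_proper \o @env_inj k g).

Lemma renv_inj_lieb x y :
  renv_inj (lieb x y) = renv_inj x * renv_inj y - renv_inj y * renv_inj x.
Proof.
rewrite /renv_inj env_inj_lieb rmorphB.
by rewrite [X in X - _]rmorphM [X in _ - X]rmorphM.
Qed.

Lemma renv_inj_ppow x : renv_inj (ppow x) = renv_inj x ^+ p.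
Proof.
have /(quot_pi_eq0 renv_rel_proper) := ideal_gen (RenvRel x).
by rewrite rmorphB rmorphXn => /subr0_eq/esym.
Qed.

Record renv_module := RenvModule {
  renv_module_vect :> vectType k;
  renv_act : {linear renv_alg -> 'End(renv_module_vect)};
  renv_act1 : renv_act 1 = \1%VF;
  renv_actM : forall u v, renv_act (u * v) = (renv_act u \o renv_act v)%VF
}.

Definition x_op (M : renv_module) (x : g) : 'End(M) := renv_act M (renv_inj x).

Lemma x_op_is_linear M : linear (x_op M).
Proof. by move=> c x y; rewrite /x_op linearP linearP. Qed.
HB.instance Definition _ (M : renv_module) :=
  GRing.isLinear.Build k g 'End(M) _ (x_op M)
  (x_op_is_linear M).

Lemma x_op_lieb M x y :
  x_op M (lieb x y) = (x_op M x \o x_op M y)%VF - (x_op M y \o x_op M x)%VF.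
Proof. by rewrite /x_op renv_inj_lieb linearB -!renv_actM. Qed.

Lemma x_op_ppow M x :
  x_op M (ppow x) = iter p (comp_lfun (x_op M x)) \1%VF.
Proof.
rewrite /x_op renv_inj_ppow; elim: p => [|n IHn] /=; first exact: renv_act1.
by rewrite exprS renv_actM IHn.
Qed.

Definition nullcone : {pred g} := [pred x : g | ppow x == 0].

Definition lie_center : {pred g} := fun x => `[< forall y : g, lieb x y = 0 >].

Definition constant_rank (M : renv_module) (d : nat) :=
  forall x, x \in nullcone -> x != 0 -> \dim (limg (x_op M x)) = d.

Definition equal_images (M : renv_module) :=
  forall x y, x \in nullcone -> x != 0 -> y \in nullcone -> y != 0 ->
  forall j, (1 <= j <= p.-1)%N ->
  limg (iter j (comp_lfun (x_op M x)) \1%VF)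
    = limg (iter j (comp_lfun (x_op M y)) \1%VF).

End RestrictedEnvelopingAlgebra.
Arguments nullcone {p k} g.
Arguments lie_center {p k} g.

Section Grassmannian.
Variables (k : fieldType) (V : vectType k).

Record grassmannian (d : nat) := Grassmannian {
  gr_space :> {vspace V};
  gr_dim : \dim gr_space == d
}.
HB.instance Definition _ d := [isSub for @gr_space d].

(* P(X), for a conical subset X of V: the lines contained in X. *)
Record proj_var (X : {pred V}) := ProjVar {
  pv_line :> {vspace V};
  pv_lineP : (\dim pv_line == 1) && `[< {subset pv_line <= X} >]
}.
HB.instance Definition _ X := [isSub for @pv_line X].

End Grassmannian.

Section ImageMap.
Variables (p : nat) (k : fieldType) (g : restrictedLieAlgType p k).
Variables (M : renv_module g) (d : nat).

Lemma nullcone_line (x : g) : x \in nullcone g -> x != 0 ->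
  (\dim <[x]> == 1) && `[< {subset <[x]>%VS <= nullcone g} >].
Proof.
move=> Vx x0; rewrite dim_vline x0; apply/asboolP => _ /vlineP[c ->].
by rewrite inE ppowZ (eqP Vx) scaler0.
Qed.

(* The point [x] of P(V(g)). *)
Definition proj_point (x : g) (Vx : x \in nullcone g) (x0 : x != 0) :
    proj_var (nullcone g) :=
  ProjVar (nullcone_line Vx x0).

Lemma vpick_neq0 (L : proj_var (nullcone g)) : vpick L != 0.
Proof.
by case: L => L /= /andP[/eqP dL _]; rewrite vpick0 -dimv_eq0 dL.
Qed.

Lemma vpick_nullcone (L : proj_var (nullcone g)) : vpick L \in nullcone g.
Proof.
by case: L => L /= /andP[_ /asboolP]; apply; exact: memv_pick.
Qed.

Lemma im_map_subproof (L : proj_var (nullcone g)) : constant_rank M d ->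
  \dim (limg (x_op M (vpick L))) == d.
Proof. by move=> cr; apply/eqP/cr; [exact: vpick_nullcone | exact: vpick_neq0]. Qed.

(* im_M : P(V(g)) -> Gr_d(M), computed on a representative of the line; the
   value does not depend on the representative, by im_map_point. *)
Definition im_map (cr : constant_rank M d) (L : proj_var (nullcone g)) :
    grassmannian M d :=
  Grassmannian (im_map_subproof L cr).

Lemma im_map_point (cr : constant_rank M d) x Vx x0 :
  gr_space (im_map cr (@proj_point x Vx x0)) = limg (x_op M x).
Proof.
rewrite /=; have [c xE] : exists c, vpick <[x]> = c *: x.
  exact/vlineP/memv_pick.
have c0 : c != 0.
  apply: contraNneq (vpick_neq0 (proj_point Vx x0)) => c0.
  by rewrite /= xE c0 scale0r.
rewrite xE linearZ /=; apply/vspaceP => w.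
apply/memv_imgP/memv_imgP => -[v _ ->].
  by exists (c *: v); rewrite ?memvf // lfunE /= linearZ.
by exists (c^-1 *: v); rewrite ?memvf // lfunE /= linearZ /= scalerA divff ?scale1r.
Qed.

End ImageMap.

(* Main.v *)
(** If [im x = im y] for two independent [x], [y], then [im (s x + t y)] is a
constant space [I] for all [(s, t) <> 0], since it is contained in [im x] and
has the same dimension. For a third element [z], the rank of [v + u z] cannot
exceed [d] for small [u], so [z] maps [ker v] into [im v = I] for every
nonzero [v] in the plane of [x] and [y]. The pencil [s x + t y] being onto [I]
for all [(s, t) <> 0] over an algebraically closed field, the kernels of its
members span [M]: the pencil induced modulo their span [U] is square and
nowhere singular, and an eigenvalue would make it singular. Hence
[im z] lies in [I].

For the second part, if [z] is central with [im x = im z], then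
[im x^(j+1) = x z^j M = z^j x M = im z^(j+1)] by induction on [j]. *)

From HB Require Import structures.
Require Import Defs.
From mathcomp Require Import all_boot all_order all_algebra.
From mathcomp Require Import boolp.
From mathcomp Require Import zify.

Set Implicit Arguments.
Unset Strict Implicit.
Unset Printing Implicit Defensive.

Import GRing.Theory VectorInternalTheory.
Local Open Scope ring_scope.

(** * Rank under perturbation of matrices *)

Lemma exists_nonzero_unit (k : closedFieldType) n (Q : 'M[k]_n) :
  exists2 u : k, u != 0 & 1%:M + u *: Q \in unitmx.
Proof.
(* A nonroot [a] of this product is nonzero and not an eigenvalue of [Q]. *)
have char0 : 'X * char_poly Q != 0.
  by rewrite mulf_neq0 ?polyX_eq0 ?monic_neq0 ?char_poly_monic.
have [a] := closed_nonrootP _ char0.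
rewrite rootM negb_or rootX -eigenvalue_root_char => /andP[a0 Qa].
exists (- a^-1); first by rewrite oppr_eq0 invr_eq0.
have -> : 1%:M + - a^-1 *: Q = - a^-1 *: (Q - a%:M).
  by rewrite scalerBr addrC scale_scalar_mx mulNr mulVf // raddfN opprK.
rewrite unitmxZ ?unitfE ?oppr_eq0 ?invr_eq0 //.
by move: Qa; rewrite negbK kermx_eq0 row_free_unit.
Qed.

Lemma eigenvalue_exists (k : closedFieldType) n (A : 'M[k]_n) : (0 < n)%N ->
  exists a, eigenvalue A a.
Proof.
move=> n_gt0.
have /closed_rootP[a] : size (char_poly A) != 1%N.
  by rewrite size_char_poly; case: n n_gt0 A.
by rewrite -eigenvalue_root_char; exists a.
Qed.

(* Otherwise a matrix of rank [\rank A + 1] would perturb to one whose rows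
   lie in the row space of [A + u *: Z] for some [u != 0]. *)
Lemma mulmx_kermx_sub (k : closedFieldType) n (A Z : 'M[k]_n) :
  (forall u, \rank (A + u *: Z)%R <= \rank A)%N -> (kermx A *m Z <= A)%MS.
Proof.
move=> rankAZ; apply/row_subP=> i; rewrite row_mul.
set q := row i _; have qA : q *m A = 0 by apply/sub_kermxP/row_sub.
apply: contraT => qZ.
have [G GE] : exists G, row_base A = G *m A.
  by apply/submxP; rewrite eq_row_base.
set N0 := col_mx (row_base A) (q *m Z).
have rankN0 : \rank N0 = (\rank A + 1)%N.
  rewrite -addsmxE (adds_eqmx (eq_row_base A) (eqmx_refl _)).
  have : (A < A + q *m Z)%MS by rewrite ltmxE addsmxSl addsmx_sub submx_refl.
  move/rank_ltmx; have := mxrank_adds_leqif A (q *m Z) => -[+ _].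
  have := rank_leq_row (q *m Z); lia.
have /row_freeP[P N0P] : row_free N0 by rewrite /row_free rankN0.
(* As [N0 *m P = 1%:M], the unit equals [(N0 + u *: col_mx (G *m Z) 0) *m P], so the perturbed [N0]
   keeps rank [\rank A + 1]. *)
have [u u0 /mxrank_unit] := exists_nonzero_unit (col_mx (G *m Z) 0 *m P).
rewrite -N0P scalemxAl -mulmxDl => rankN.
have : ((N0 + u *: col_mx (G *m Z) 0)%R <= (A + u *: Z)%R)%MS.
  rewrite scale_col_mx scaler0 add_col_mx addr0 GE scalemxAr -mulmxDr.
  rewrite -addsmxE addsmx_sub submxMl.
  apply/submxP; exists (u^-1 *: q).
  by rewrite -scalemxAl mulmxDr qA add0r -scalemxAr scalerA mulVf // scale1r.
move/mxrankS=> /leq_trans/(_ (rankAZ u)).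
by have := mxrankM_maxl (N0 + u *: col_mx (G *m Z) 0)%R P; rewrite rankN; lia.
Qed.

(** * Kernels in a pencil of constant rank *)

Section Pencil.
Variables (k : closedFieldType) (n : nat) (X Y : 'M[k]_n).
Local Notation ker s := (kermx (s *: X + Y)%R).
Local Notation kers S := (\sum_(s <- S) ker s)%MS.

Lemma kers_sup (S : seq k) s : s \in S -> (ker s <= kers S)%MS.
Proof.
elim: S => // t S IH; rewrite inE big_cons => /predU1P[->|/IH kS].
  exact: addsmxSl.
exact: submx_trans kS (addsmxSr _ _).
Qed.

Lemma kers_mul_sub (S : seq k) m (B : 'M[k]_(n, m)) r (D : 'M[k]_(r, m)) :
  (forall s, s \in S -> (ker s *m B <= D)%MS) -> (kers S *m B <= D)%MS.
Proof.
elim: S => [|t S IH] kD; first by rewrite big_nil mul0mx sub0mx.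
rewrite big_cons addsmxMr addsmx_sub kD ?mem_head //=; apply: IH => s sS.
by apply: kD; rewrite inE sS orbT.
Qed.

(** Adjoining a kernel not yet contained in the sum raises its rank, which is at most [n]. *)
Lemma kers_max : exists S : seq k, forall s, (ker s <= kers S)%MS.
Proof.
suff ext c S : (n - \rank (kers S) <= c)%N ->
    exists S' : seq k, forall s, (ker s <= kers S')%MS.
  exact: (ext n [::] (leq_subr _ _)).
elim: c S => [|c IH] S rS.
  exists S => s; apply: submx_full; rewrite /row_full eqn_leq rank_leq_col /=.
  by rewrite -subn_eq0 -leqn0.
have [maxS|/existsNP[s /negP ks]] :=
  EM (forall s, (ker s <= kers S)%MS); first by exists S.
apply: (IH (s :: S)).
have : (\rank (kers S) < \rank (kers (s :: S)))%N.
  apply: rank_ltmx; rewrite big_cons ltmxE addsmxSr.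
  by rewrite addsmx_sub submx_refl andbT.
move: (\rank _) (\rank _) rS => r r'; lia.
Qed.

Lemma ker_mulY s : ker s *m Y = - s *: (ker s *m X).
Proof.
apply/eqP; rewrite scaleNr -addr_eq0 addrC scalemxAr -mulmxDr.
by rewrite mulmx_ker.
Qed.

(** Let [U] be a maximal sum of kernels and [C] a complement. The pencil maps [C] to the row space
    of [X] modulo [U *m X]; both have dimension [n - \rank U], so an eigenvalue would give a member
    of rank below [d]. *)
Lemma kers_full (d : nat) : \rank X = d -> (forall s, \rank (s *: X + Y)%R = d) ->
  (Y <= X)%MS -> exists S : seq k, row_full (kers S).
Proof.
move=> rX rXY sYX; have [S maxS] := kers_max; exists S.
set U := kers S in maxS *; apply: contraT => nfull.
have UY : (U *m Y <= U *m X)%MS.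
  apply: kers_mul_sub => s sS.
  by rewrite ker_mulY scalemx_sub // submxMr // kers_sup.
have UXY s : (U *m (s *: X + Y)%R <= U *m X)%MS.
  by rewrite mulmxDr addmx_sub // -scalemxAr scalemx_sub.
(* Off [S], the member [s0 *: X + Y] is a nonzero multiple of [X] on each summand of [U], so it maps
   [U] onto [U *m X]. *)
have [s0 s0S] : exists s0, s0 \notin S.
  have : \prod_(s <- S) ('X - s%:P) != 0 by rewrite monic_neq0 ?monic_prod_XsubC.
  by move/closed_nonrootP=> [s0]; rewrite root_prod_XsubC; exists s0.
have UX : (U *m X <= U *m (s0 *: X + Y)%R)%MS.
  apply: kers_mul_sub => s sS.
  have s0s : s0 - s != 0 by rewrite subr_eq0; apply: contraNneq s0S => ->.
  have -> : ker s *m X = (s0 - s)^-1 *: (ker s *m (s0 *: X + Y)%R).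
    rewrite mulmxDr ker_mulY -scalemxAr -scalerDl scalerA mulVf //.
    by rewrite scale1r.
  by rewrite scalemx_sub // submxMr // kers_sup.
have dn : (d <= n)%N by rewrite -rX rank_leq_row.
have rU := rank_leq_row U.
(* By maximality [U] contains the whole kernel of [s0 *: X + Y], of dimension [n - d]. *)
have rUX : (\rank (U *m X) + (n - d) = \rank U)%N.
  have -> : \rank (U *m X) = \rank (U *m (s0 *: X + Y)%R).
    by apply: eqmx_rank; rewrite UX UXY.
  rewrite -(mxrank_mul_ker U (s0 *: X + Y)%R); congr addn.
  by rewrite (capmx_idPr (maxS s0)) mxrank_ker rXY.
set C := row_base U^C%MS.
have c_gt0 : (0 < \rank (U^C)%MS)%N.
  by rewrite mxrank_compl subn_gt0 ltn_neqAle nfull.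
have full_UC m (B : 'M[k]_(n, m)) : (B <= U *m B + C *m B)%MS.
  rewrite -addsmxMr -[X in (X <= _)%MS]mul1mx submxMr //.
  rewrite (adds_eqmx (eqmx_refl _) (eq_row_base _)) submx_full //.
  exact: addsmx_compl_full.
(* [T] represents [Y] relative to [X] on [C], modulo [U *m X]. *)
have /sub_addsmxP[[E T] /= CY] : (C *m Y <= U *m X + C *m X)%MS.
  exact: submx_trans (submx_trans (submxMl _ _) sYX) (full_UC _ _).
have [a /eigenvalueP[e eT e0]] := eigenvalue_exists T c_gt0.
set D := C *m (- a *: X + Y)%R.
have eD : (e *m D <= U *m X)%MS.
  rewrite /D mulmxDr CY -scalemxAr mulmxDr mulmxDr (mulmxA e T) eT.
  by rewrite -scalemxAl -scalemxAr scaleNr addrCA addNr addr0 mulmxA submxMl.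
have : ((- a *: X + Y)%R <= U *m X + D)%MS.
  exact: submx_trans (full_UC _ _) (addsmxS (UXY _) (submx_refl _)).
move/mxrankS; rewrite rXY => dUD.
have rsum := mxrank_sum_cap (U *m X) D.
have rD := rank_leq_row D; have rC := mxrank_compl U.
(* The ranks of [U *m X] and [D] add up to at most [d], yet their sum has rank at least [d]: it is
   direct and the rows of [D] are independent. *)
have cap0 : \rank (U *m X :&: D)%MS = 0%N by lia.
have : row_free D by rewrite /row_free; lia.
move/row_free_inj=> Dinj; case/eqP: e0; apply: (Dinj _); rewrite mul0mx.
apply/eqP; rewrite -submx0.
have /eqP <- : (U *m X :&: D)%MS == 0 by rewrite -mxrank_eq0 cap0.
by rewrite sub_capmx eD submxMl.
Qed.

Lemma pencil_sub (d : nat) (Z : 'M[k]_n) : \rank X = d ->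
  (forall s, \rank (s *: X + Y)%R = d) ->
  (forall s u, \rank (s *: X + Y + u *: Z)%R <= d)%N ->
  (Y <= X)%MS -> (Z <= X)%MS.
Proof.
move=> rX rXY rXYZ sYX; have [S fullS] := kers_full rX rXY sYX.
have sXY s : ((s *: X + Y)%R <= X)%MS by rewrite addmx_sub // scalemx_sub.
have : (kers S *m Z <= X)%MS.
  apply: kers_mul_sub => s _; apply: submx_trans (sXY s).
  by apply: mulmx_kermx_sub => u; rewrite rXY.
by apply: submx_trans; rewrite -[X in (X <= _)%MS]mul1mx submxMr ?submx_full.
Qed.

End Pencil.

(** * Images of endomorphisms as row spaces *)

Section LinearImage.
Variables (k : fieldType) (V : vectType k).
Implicit Types f h : 'End(V).

Lemma vs2mx_limg f : (vs2mx (limg f) :=: f2mx f)%MS.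
Proof.
rewrite /lfun_img locked_withE; apply: eqmx_trans (mx2vsK _) _.
apply/eqmxP; rewrite submxMl -[X in (X <= _)%MS]mul1mx submxMr // submx_full //.
by rewrite /row_full (mx2vsK 1%:M) mxrank1.
Qed.

Lemma f2mx_is_linear : linear (@f2mx k V V).
Proof.
move=> c f h.
have f2mxE e v : v *m f2mx e = v2r (e (r2v v)) by rewrite unlock /= !r2vK.
apply/row_matrixP => i; rewrite !rowE mulmxDr -scalemxAr !f2mxE.
by rewrite !lfunE /= !lfunE /= linearP.
Qed.
HB.instance Definition _ := GRing.isLinear.Build k 'End(V) _ _ (@f2mx k V V)
  f2mx_is_linear.

Lemma dim_limg f : \dim (limg f) = \rank (f2mx f).
Proof. by rewrite /dimv vs2mx_limg. Qed.

Lemma limg_subE f h : (limg f <= limg h)%VS = (f2mx f <= f2mx h)%MS.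
Proof. by rewrite /subsetv !vs2mx_limg. Qed.

Lemma limg_iter_commute f h j : (f \o h = h \o f)%VF -> limg f = limg h ->
  limg (iter j (comp_lfun f) \1%VF) = limg (iter j (comp_lfun h) \1%VF).
Proof.
move=> fh im_fh; elim: j => //= j IH.
have fhj : (f \o iter j (comp_lfun h) \1 = iter j (comp_lfun h) \1 \o f)%VF.
  elim: j {IH} => [|j IH] /=; first by rewrite comp_lfun1l comp_lfun1r.
  by rewrite comp_lfunA fh -comp_lfunA IH comp_lfunA.
have hhj : (h \o iter j (comp_lfun h) \1 = iter j (comp_lfun h) \1 \o h)%VF.
  elim: j {IH fhj} => [|j IH] /=; first by rewrite comp_lfun1l comp_lfun1r.
  by rewrite -comp_lfunA -IH.
by rewrite limg_comp IH -limg_comp fhj hhj !limg_comp im_fh.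
Qed.

End LinearImage.

(** * The image map on lines of the nullcone *)

Section ImageMap.
Variables (k : closedFieldType) (p : nat) (g : restrictedLieAlgType p k).
Variables (M : renv_module g) (d : nat) (rankM : constant_rank M d).
Implicit Types L : proj_var (nullcone g).

Lemma im_map_eq L1 L2 : im_map rankM L1 = im_map rankM L2 <->
  limg (x_op M (vpick L1)) = limg (x_op M (vpick L2)).
Proof. by split=> [/(congr1 val)|im_eq]; last exact: val_inj. Qed.

Lemma vline_vpick L : (<[vpick L]> = L)%VS.
Proof.
apply/eqP; rewrite eqEdim -memvE memv_pick dim_vline vpick_neq0.
by case: L => L /= /andP[/eqP->].
Qed.

(** As [W] is closed under linear combinations, constant rank applies to every nonzero combination
    of [x], [y], [z] and yields the hypotheses of [pencil_sub]. *)
Lemma constant_of_collision (W : {vspace g}) L1 L2 : W =i nullcone g ->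
  L1 <> L2 -> im_map rankM L1 = im_map rankM L2 ->
  forall L, im_map rankM L = im_map rankM L1.
Proof.
move=> WE L12 /im_map_eq im12 L; apply/im_map_eq.
set x := vpick L1 in im12 *; set y := vpick L2 in im12; set z := vpick L.
have [xW yW zW] : [/\ x \in W, y \in W & z \in W].
  by rewrite !WE !vpick_nullcone.
(* Otherwise [x] and [y] would span the same line. *)
have xy0 s : s *: x + y != 0.
  apply: contra_notN L12; rewrite addrC addr_eq0 -scaleNr => /eqP yE.
  apply: val_inj; rewrite /= -[pv_line L1]vline_vpick -[pv_line L2]vline_vpick.
  apply/esym/eqP; rewrite eqEdim !dim_vline !vpick_neq0 leqnn andbT.
  by rewrite -memvE; apply/vlineP; exists (- s).
have rankW v : v \in W -> v != 0 -> \rank (f2mx (x_op M v)) = d.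
  by rewrite WE => vW v0; rewrite -dim_limg rankM.
have f2mx_xop c v w :
    f2mx (x_op M (c *: v + w)) = c *: f2mx (x_op M v) + f2mx (x_op M w).
  by rewrite !linearP.
have rx := rankW x xW (vpick_neq0 _).
have rz := rankW z zW (vpick_neq0 _).
apply/eqP; rewrite eqEdim !dim_limg rx rz leqnn andbT limg_subE.
apply: (pencil_sub (Y := f2mx (x_op M y)) rx) => [s|s u|].
- by rewrite -f2mx_xop rankW // memvD ?memvZ.
- rewrite -f2mx_xop addrC -f2mx_xop; set v := _ + _.
  (* [v] can vanish when [z] lies in the plane of [x] and [y]. *)
  have [->|v0] := eqVneq v 0; first by rewrite !linear0 mxrank0.
  by rewrite rankW // !memvD ?memvZ.
- by rewrite -limg_subE im12.
Qed.

End ImageMap.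

Theorem theorem3p2p2 (k : closedFieldType) (p : nat) (charkp : p \in [pchar k])
    (g : restrictedLieAlgType p k) (M : renv_module g) (d : nat)
    (rankM : constant_rank M d) :
  ((exists W : {vspace g}, W =i nullcone g) ->
     injective (im_map rankM)
     \/ (forall L1 L2, im_map rankM L1 = im_map rankM L2))
  /\
  ((exists x : g, [/\ x \in nullcone g, x \in lie_center g & x != 0]) ->
     (forall L1 L2, im_map rankM L1 = im_map rankM L2) ->
     equal_images M).
Proof.
split=> [[W WE]|[z [Vz /asboolP Cz z0]] im_const].
  have [?|/existsNP[L1 /existsNP[L2 /not_implyP[im12 L12]]]] :=
    EM (injective (im_map rankM)); first by left.
  by right=> L L'; rewrite !(constant_of_collision WE L12 im12).
(* The central [z] serves as common reference, since its action commutes with that of every [x]. *)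
suff imz x : x \in nullcone g -> x != 0 -> forall j,
    limg (iter j (comp_lfun (x_op M x)) \1%VF)
      = limg (iter j (comp_lfun (x_op M z)) \1%VF).
  by move=> x y Vx x0 Vy y0 j _; rewrite !imz.
move=> Vx x0 j; apply: limg_iter_commute.
  by apply/esym/subr0_eq; rewrite -x_op_lieb Cz linear0.
rewrite -(im_map_point rankM Vx x0) -(im_map_point rankM Vz z0).
by congr gr_space; exact: im_const.
Qed.
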